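(* If $2^{\aleph_1} = \aleph_2$, then there is an atomic boolean algebra $\mathcal{B}$ such that $\pi(\mathcal{B}) = \aleph_1 < \mathrm{Irr}_{\mathrm{mm}}(\mathcal{B})$.
   Context: Let $\mathcal{B}$ be a boolean algebra with least element $0$. A subset $\mathcal{S} \subseteq \mathcal{B}$ is dense in $\mathcal{B}$ iff for every $b \in \mathcal{B}\setminus\{0\}$ there is $d \in \mathcal{S}\setminus\{0\}$ with $d \le b$. The pi-weight $\pi(\mathcal{B})$ is the least size of a dense subset of $\mathcal{B}$. For $\mathcal{E} \subseteq \mathcal{B}$, $\mathrm{sa}(\mathcal{E})$ is the sub-algebra of $\mathcal{B}$ generated by $\mathcal{E}$. $\mathcal{E}$ is irredundant iff $a \notin \mathrm{sa}(\mathcal{E}\setminus\{a\})$ for all $a \in \mathcal{E}$. A maximal irredundant subset of $\mathcal{B}$ is an irredundant subset not properly contained in any irredundant subset of $\mathcal{B}$. $\mathrm{Irr}_{\mathrm{mm}}(\mathcal{B})$ is the minimum size of a maximal irredundant subset of $\mathcal{B}$. *)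

(* Defs.v *)
From HB Require Import structures.
From mathcomp Require Import all_boot all_order.
From mathcomp Require Import boolp classical_sets functions cardinality.

Set Implicit Arguments.
Unset Strict Implicit.
Unset Printing Implicit Defensive.

Local Open Scope classical_set_scope.
Local Open Scope card_scope.
Local Open Scope order_scope.

(* Cardinals are represented by sets, compared with [#<=] and [#=]. *)

Definition card_lt T U (A : set T) (B : set U) : Prop :=
  (A #<= B) /\ ~ (B #<= A).

Definition card_succ T U (A : set T) (B : set U) : Prop :=
  card_lt A B /\
  forall (V : Type) (C : set V), card_lt A C -> B #<= C.

Fixpoint is_aleph (n : nat) (T : Type) (A : set T) : Prop :=
  match n with
  | 0 => A #= [set: nat]
  | n'.+1 => exists (U : Type) (C : set U), is_aleph n' C /\ card_succ C A
  end.

(* |K| = min { |S| : P S }, the minimum being attained. *)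
Definition is_min_card T U (P : set (set T)) (K : set U) : Prop :=
  (exists2 S, P S & S #= K) /\ forall S, P S -> K #<= S.

(* Boolean algebras are complemented distributive lattices with bottom and
   top, [ctbDistrLatticeType d]; the display [d] only affects printing. *)
Section BooleanAlgebra.
Context {d : Order.disp_t} (B : ctbDistrLatticeType d).
Implicit Types (S E : set B) (a b x : B).

Definition atom a : Prop :=
  a <> \bot /\ forall x, x <= a -> x = \bot \/ x = a.

Definition atomic : Prop :=
  forall b, b <> \bot -> exists2 a, atom a & a <= b.

Definition dense_in S : Prop :=
  forall b, b <> \bot -> exists x, [/\ S x, x <> \bot & x <= b].

Definition subalgebra S : Prop :=
  [/\ S \bot, S \top, (forall a, S a -> S (~` a)),
      (forall a b, S a -> S b -> S (a `&` b)) &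
      (forall a b, S a -> S b -> S (a `|` b))].

Definition sa E : set B := smallest subalgebra E.

Definition irredundant E : Prop :=
  forall a, E a -> ~ sa (E `\ a)%classic a.

Definition maximal_irredundant E : Prop :=
  irredundant E /\ forall F, irredundant F -> (E `<=` F)%classic -> F = E.

Definition is_pi_weight U (K : set U) : Prop := is_min_card dense_in K.

Definition is_Irr_mm U (K : set U) : Prop :=
  is_min_card maximal_irredundant K.

End BooleanAlgebra.

(* Main.v *)
(* The algebra is a subalgebra A of the power set of W generated by the
   singletons and by sets b_f, for f : W -> bool, chosen by recursion along a
   well-order of W -> bool whose initial segments have size at most aleph_1.
   Every element of A is finite or uncountable, because b_f cuts every
   uncountable set of the algebra generated by the earlier choices into two
   uncountable pieces.  Moreover f codes a family E of at most aleph_1 subsets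
   of W; as (W -> bool) surjects onto such codes, every E is treated, and b_f is
   chosen so that E is not maximal irredundant.

   Let E be irredundant, with all elements of sa E finite or uncountable.  A
   singleton outside sa E can be adjoined to E, so let sa E contain them all.
   Call two points neighbours if at most one element of E separates them.  A
   singleton of sa E depends on countably many elements of E, and each of these
   accounts for at most one neighbour; so the neighbour graph has countable
   components, and a Bernstein-type recursion gives a union b of components
   that splits all uncountable elements of sa E.  If adjoining b made some a in
   E redundant, then a = (c & b) | (d - b) with c, d in F = sa (E - a).  The
   symmetric differences x of a, d and y of a, c are separated by b, so both
   are finite; x | y is in F but x is not, so some point of x and some point of
   y are not separated by F.  They are neighbours on different sides of b,
   which is absurd. *)
From HB Require Import structures.
Require Import Defs.
From Stdlib Require Import Wellfounded.
From mathcomp Require Import all_boot all_order.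
From mathcomp Require Import boolp classical_sets functions cardinality wochoice.

Set Implicit Arguments.
Unset Strict Implicit.
Unset Printing Implicit Defensive.

Import Order.TTheory Order.CTheory.

Local Open Scope classical_set_scope.
Local Open Scope card_scope.

(** * Cardinals and well-orders *)

Lemma card_le_range T U (A : set T) :
  A #<= [set: U] -> A = set0 \/ exists g : U -> T, A = range g.
Proof.
by case/pfcard_geP=> [->|/surjfunPex[g ->]]; [left|right; exists g].
Qed.

Lemma card_le_injfun T U (A : set T) (B : set U) (f : T -> U) :
  set_fun A B f -> {in A &, injective f} -> A #<= B.
Proof.
move=> fAB finj; have /injfunPex[g] : exists2 f, set_fun A B f & set_inj A f.
  by exists f.
exact: inj_card_le.
Qed.

Lemma card_le_setT_inj T U (A : set U) : [set: T] #<= A ->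
  exists2 f : T -> U, injective f & forall t, A (f t).
Proof.
move=> /card_leP[f]; exists (fun t => val (f (to_setT t))).
  move=> x y /val_inj.
  by move=> /(@inj _ _ _ f); rewrite !inE => /(_ I I) /(congr1 val).
by move=> t; apply: set_valP.
Qed.

Definition is_wo I (lt : I -> I -> Prop) : Prop :=
  [/\ well_founded lt, (forall i j k, lt i j -> lt j k -> lt i k) &
      forall i j, [\/ lt i j, i = j | lt j i]].

Lemma wo_exists I : exists lt : I -> I -> Prop, is_wo lt.
Proof.
elim/Peq: I => I; have [R Rwo] := well_ordering_principle I.
(* [R] is given through unique least elements of nonempty predicates; totality, antisymmetry and
   transitivity are read off from sets of two or three points. *)
have Rtot x y : R x y \/ R y x.
  have [|z [[zA zl] _]] := Rwo (pred2 x y); first by exists x; rewrite !inE eqxx.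
  by move: zA; rewrite !inE => /orP[]/eqP <-; [left|right]; apply: zl;
     rewrite !inE eqxx ?orbT.
have Rrefl x : R x x by case: (Rtot x x).
have Ranti x y : R x y -> R y x -> x = y.
  move=> Rxy Ryx; have [|z [_ zu]] := Rwo (pred2 x y).
    by exists x; rewrite !inE eqxx.
  rewrite -(zu x) ?(zu y)//; split; rewrite ?inE ?eqxx ?orbT// => u;
    by rewrite !inE => /orP[]/eqP ->.
have Rtr x y z : R x y -> R y z -> R x z.
  move=> Rxy Ryz; have [|t [[tA tl] _]] := Rwo (pred3 x y z).
    by exists x; rewrite !inE eqxx.
  have tx : R t x by apply: tl; rewrite !inE eqxx.
  have ty : R t y by apply: tl; rewrite !inE eqxx ?orbT.
  have tz : R t z by apply: tl; rewrite !inE eqxx ?orbT.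
  move: tA; rewrite !inE => /or3P[]/eqP tE; subst t => //.
    by rewrite (Ranti x y).
  by rewrite -(Ranti y z).
exists (fun x y => R x y /\ x <> y); split.
- move=> x; apply: contrapT => nx.
  pose A := [pred y | `[< ~ Acc (fun x y => R x y /\ x <> y) y >]].
  have [|z [[zA zl] _]] := Rwo A; first by exists x; apply/asboolP.
  move: zA => /asboolP; apply; constructor=> y [Ryz yz].
  apply: contrapT => ny; apply/yz/(Ranti _ _ Ryz)/zl.
  exact/asboolP.
- move=> x y z [Rxy xy] [Ryz yz]; split; first exact: Rtr Ryz.
  by move=> xz; subst z; apply: xy; apply: Ranti.
- move=> x y; have [->|/eqP xy] := eqVneq x y; first by constructor 2.
  by have [Rxy|Ryx] := Rtot x y; [constructor 1|constructor 3; split=> // /esym].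
Qed.

(* Pull a well-order back to its least initial segment that is too long. *)
Lemma wo_short_exists I U (K : set U) :
    (forall (C : set I), ~ (C #<= K) -> [set: I] #<= C) ->
  exists2 lt : I -> I -> Prop, is_wo lt & forall i, [set j | lt j i] #<= K.
Proof.
move=> Kmin; have [lt [ltwf lttr lttot]] := wo_exists I.
have [|/existsNP[i0 i0P]] := pselect (forall i, [set j | lt j i] #<= K).
  by exists lt.
have [i iK imin] : exists2 i, ~ ([set j | lt j i] #<= K) &
    forall j, lt j i -> [set k | lt k j] #<= K.
  elim: {i0}(ltwf i0) i0P => i _ IH iK.
  have [|/existsNP[j /not_implyP[ji jK]]] :=
    pselect (forall j, lt j i -> [set k | lt k j] #<= K); first by exists i.
  exact: IH jK.
have [f finj fi] := card_le_setT_inj (Kmin _ iK).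
exists (fun j k => lt (f j) (f k)); first split.
- exact: wf_inverse_image.
- by move=> *; apply: lttr; eauto.
- move=> j k; have [jk|/finj jk|jk] := lttot (f j) (f k).
  + by constructor 1.
  + by constructor 2.
  + by constructor 3.
- move=> j; apply: card_le_trans (imin _ (fi j)).
  by apply: (@card_le_injfun _ _ _ _ f) => // x y _ _; apply: finj.
Qed.

(** Transfinite recursion in which a choice sees the earlier ones only through the set [D] of their
    values, together with a bound on its size. *)
Lemma wf_choice I T (lt : I -> I -> Prop) (Phi : I -> set T -> T -> Prop) :
    well_founded lt ->
    (forall i D, D #<= [set j | lt j i] -> exists t, Phi i D t) ->
  exists c : I -> T, forall i, Phi i (c @` [set j | lt j i]) (c i).
Proof.
move=> ltwf Phiex.
have /choice[f fP] : forall iD : I * set T, exists t,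
    iD.2 #<= [set j | lt j iD.1] -> Phi iD.1 iD.2 t.
  move=> [i D] /=.
  have [/Phiex[t]|nD] := pselect (D #<= [set j | lt j i]); first by exists t.
  (* An oversized [D] never occurs in the recursion; the empty set only serves to show that [T] is
     inhabited, which gives a default value. *)
  by have [t _] := Phiex i set0 (card_ge0 _ _); exists t.
pose F i (rec : forall j, lt j i -> T) : T :=
  f (i, [set t | exists j (ji : lt j i), t = rec j ji]).
have FE i rec rec' : (forall j ji, rec j ji = rec' j ji) -> F i rec = F i rec'.
  move=> recE; congr (f (i, _)); apply/seteqP; split=> t [j [ji ->]];
  by exists j, ji.
exists (Fix ltwf (fun=> T) F) => i; rewrite [X in Phi _ _ X]Fix_eq//.
rewrite [X in Phi _ _ X]/F; set D := (X in f (_, X)).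
have -> : D = Fix ltwf (fun=> T) F @` [set j | lt j i].
  by apply/seteqP; split=> t [j]; [case=> ji ->; exists j|move=> ji <-; exists j, ji].
exact/(fP (_, _))/card_image_le.
Qed.

(** * Arithmetic of the first uncountable cardinal *)

Lemma countableU T (A B : set T) :
  countable A -> countable B -> countable (A `|` B).
Proof.
move=> Ac Bc; rewrite -bigcup2E; apply: bigcup_countable => // -[|[|n]] _ //=.
Qed.

Lemma uncountable_setD T (A B : set T) :
  ~ countable A -> countable B -> ~ countable (A `\` B).
Proof.
move=> Anc Bc ABc; apply: Anc; apply: (@sub_countable _ _ _ ((A `\` B) `|` B)).
  by apply: subset_card_le => x Ax; have [Bx|nBx] := pselect (B x); [right|left].
exact: countableU.
Qed.

Lemma uncountable_nonempty T (A : set T) : ~ countable A -> A !=set0.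
Proof.
by move=> Anc; apply/set0P; apply: contra_not_neq Anc => ->; apply: countable0.
Qed.

Section Aleph1.
Variables (W : Type) (lt : W -> W -> Prop).
Hypotheses (ltwo : is_wo lt) (lt_countable : forall w, countable [set v | lt v w]).
Hypothesis W_uncountable : ~ countable [set: W].

Lemma wo_greedy_choice T (P : W -> set T) (rel : T -> T -> Prop) :
    (forall w D, countable D -> exists2 t, P w t & forall s, D s -> rel s t) ->
  exists c : W -> T, (forall w, P w (c w)) /\ forall v w, lt v w -> rel (c v) (c w).
Proof.
move=> Pex; have [ltwf _ _] := ltwo.
pose Phi w D t := P w t /\ forall s, D s -> rel s t.
have [w D Dw|c cP] := @wf_choice _ _ lt Phi ltwf.
  by have [|t] := Pex w D; [exact: sub_countable Dw _|exists t].
exists c; split=> [w|v w vw]; first by have [] := cP w.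
by have [_] := cP w; apply; exists v.
Qed.

(** Injective sequences with pairwise disjoint ranges are picked one after the other: countably many
    earlier ranges leave an uncountable part of [W]. *)
Lemma inj_Wnat : exists h : W -> nat -> W,
  forall v m w n, h v m = h w n -> v = w /\ m = n.
Proof.
have [w D Dc|h [hinj hdisj]] := @wo_greedy_choice _
    (fun=> [set g : nat -> W | injective g]) (fun g g' => forall m n, g m <> g' n).
  have Uc : countable (\bigcup_(g in D) range g).
    by apply: bigcup_countable => // g _; apply: card_image_le.
  have := uncountable_setD W_uncountable Uc.
  move=> /(contra_not (@finite_set_countable _ _)) /infiniteP.
  move=> /card_le_setT_inj[g ginj gU]; exists g => //= s Ds m n smn.
  by have [_] := gU n; apply; exists s => //; exists m.
exists h => v m w n e; have [_ _ tot] := ltwo.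
have [/hdisj/(_ m n)//|vw|/hdisj/(_ n m)] := tot v w; last by rewrite e.
by subst w; split=> //; apply: hinj e.
Qed.

Lemma inj_WW : exists p : W * W -> W, injective p.
Proof.
have [h hinj] := inj_Wnat; have [_ _ tot] := ltwo.
have /choice[j jinj] : forall w, exists f : W -> nat,
    {in [set v | lt v w \/ v = w] &, injective f}.
  move=> w; apply/countable_injP.
  by apply: (@countableU _ [set v | lt v w] [set w]).
(* A pair with maximum [w] is coded by [w] and two indices below [w]. *)
pose q w (u v : W) := h w (choice.pickle (j w u, j w v)).
have qinj w u v w' u' v' : lt u w \/ u = w -> lt v w \/ v = w ->
    lt u' w' \/ u' = w' -> lt v' w' \/ v' = w' ->
    q w u v = q w' u' v' -> u = u' /\ v = v'.
  move=> uw vw uw' vw' /hinj[ww']; subst w'.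
  move=> /(pcan_inj choice.pickleK)[ju jv].
  by split; apply: (jinj w) => //; rewrite inE.
pose mx u v := if `[< lt u v >] then v else u.
have mxP u v : (lt u (mx u v) \/ u = mx u v) /\ (lt v (mx u v) \/ v = mx u v).
  rewrite /mx; case: asboolP => uv; first by split; [left|right].
  by split; [right|have [|->|] := tot u v; [|right|left]].
exists (fun uv => q (mx uv.1 uv.2) uv.1 uv.2) => -[u v] [u' v'] /= /qinj.
by move=> []; try (by have [] := mxP u v); try (by have [] := mxP u' v'); move=> -> ->.
Qed.

Lemma card_le_WW : [set: W * W] #<= [set: W].
Proof.
have [p pinj] := inj_WW.
by apply: (@card_le_injfun _ _ _ _ p) => // ? ? _ _ /pinj.
Qed.

Lemma card_le_bigcup I T (D : set I) (F : I -> set T) :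
  D #<= [set: W] -> (forall i, D i -> F i #<= [set: W]) ->
  \bigcup_(i in D) F i #<= [set: W].
Proof.
move=> DW FW; have [->|/set0P[t0 _]] := eqVneq (\bigcup_(i in D) F i) set0.
  exact: card_ge0.
have [->|[f Df]] := card_le_range DW; first by rewrite bigcup_set0 card_ge0.
have /choice[g gP] : forall w, exists g : W -> T, F (f w) `<=` range g.
  move=> w; have [|->|[g ->]] := @card_le_range _ W (F (f w)).
  - by apply: FW; rewrite Df; exists w.
  - by exists (fun=> t0) => ?.
  - by exists g.
apply: card_le_trans (_ : range (fun vw : W * W => g vw.1 vw.2) #<= _).
  apply: subset_card_le => t [i]; rewrite Df => -[w _ <-] /gP[v _ <-].
  by exists (w, v).
exact: card_le_trans (card_image_le _ _) card_le_WW.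
Qed.

Lemma countable_card_le T (A : set T) : countable A -> A #<= [set: W].
Proof.
move=> /card_le_trans; apply; apply/infiniteP.
by move=> /finite_set_countable.
Qed.

Lemma card_le_setU T (A B : set T) :
  A #<= [set: W] -> B #<= [set: W] -> A `|` B #<= [set: W].
Proof.
move=> AW BW; rewrite -bigcup2E; apply: card_le_bigcup; first exact: countable_card_le.
by move=> [|[|n]] _ //=; apply: card_ge0.
Qed.

End Aleph1.

(** * Generated subalgebras and irredundance *)

Section Generated.
Context {d : Order.disp_t} (B : ctbDistrLatticeType d).
Implicit Types (S E F : set B) (a b x : B).

Lemma sa_subalgebra E : subalgebra (sa E).
Proof.
split=> [S [[]]//|S [[]]//|a Ea S SE|a b Ea Eb S SE|a b Ea Eb S SE];
  case: (SE) => -[? ? SC SI SU] _.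
- by apply: SC; apply: Ea.
- by apply: SI; [apply: Ea|apply: Eb].
- by apply: SU; [apply: Ea|apply: Eb].
Qed.

Lemma sa_mono E F : E `<=` F -> sa E `<=` sa F.
Proof. by move=> EF; apply: sub_smallest2r => //; apply: sa_subalgebra. Qed.

Lemma sa_sub E S : subalgebra S -> E `<=` S -> sa E `<=` S.
Proof. exact: smallest_sub. Qed.

Lemma sub_sa E : E `<=` sa E.
Proof. exact: sub_gen_smallest. Qed.

(** The operations are finitary, so a union of a chain of subalgebras is a subalgebra; a member of
    [D] supplies the constants. *)
Lemma sa_bigcup_chain (I : Type) (D : set I) (F : I -> set B) :
    D !=set0 -> (forall i j, D i -> D j -> F i `<=` F j \/ F j `<=` F i) ->
  sa (\bigcup_(i in D) F i) `<=` \bigcup_(i in D) sa (F i).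
Proof.
move=> [i0 Di0] chain; have saP i := sa_subalgebra (F i).
apply: sa_sub; last by move=> x [i Di Fx]; exists i => //; apply: sub_sa.
have dir i j : D i -> D j ->
    exists2 k, D k & sa (F i) `<=` sa (F k) /\ sa (F j) `<=` sa (F k).
  move=> Di Dj; have [ij|ji] := chain i j Di Dj.
    by exists j => //; split=> //; apply: sa_mono.
  by exists i => //; split=> //; apply: sa_mono.
split.
- by exists i0 => //; have [] := saP i0.
- by exists i0 => //; have [] := saP i0.
- by move=> a [i Di Fa]; exists i => //; have [_ _ + _ _] := saP i; apply.
- move=> a b [i Di Fa] [j Dj Fb]; have [k Dk [ik jk]] := dir _ _ Di Dj.
  by exists k => //; have [_ _ _ + _] := saP k; apply; [apply: ik|apply: jk].
- move=> a b [i Di Fa] [j Dj Fb]; have [k Dk [ik jk]] := dir _ _ Di Dj.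
  by exists k => //; have [_ _ _ _ +] := saP k; apply; [apply: ik|apply: jk].
Qed.

(** Zorn's lemma applies because a redundancy in the union of a chain already occurs in one
    member. *)
Lemma maximal_irredundant_exists : exists E, @maximal_irredundant d B E.
Proof.
have [|E [Eirr Emax]] := @Zorn_bigcup B (@irredundant d B); last first.
  exists E; split=> // F Firr EF; apply/seteqP; split=> //.
  by apply: contrapT => FE; apply: (Emax F).
move=> F Firr Ftot a [X FX Xa].
have -> : (\bigcup_(X in F) X) `\ a = \bigcup_(X in F) (X `\ a).
  by rewrite setD_bigcupl.
case/sa_bigcup_chain.
- by exists X.
- by move=> Y Z FY FZ; have [YZ|ZY] := Ftot Y Z FY FZ; [left|right]; apply: setSD.
- move=> Y FY saY; have [XY|YX] := Ftot X Y FX FY.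
    by apply: (Firr Y FY a) => //; apply: XY.
  by apply: (Firr X FX a) => //; apply: sa_mono saY; apply: setSD.
Qed.

Section Card.
Variables (W : Type) (lt : W -> W -> Prop).
Hypotheses (ltwo : is_wo lt) (lt_countable : forall w, countable [set v | lt v w]).
Hypothesis W_uncountable : ~ countable [set: W].

(** All operations are composed from [nand] and the top, so countably many rounds of closing under
    [nand] exhaust [sa E], and each round stays within the size of [W * W]. *)
Lemma card_le_sa E : E #<= [set: W] -> sa E #<= [set: W].
Proof.
move=> EW.
pose nand (xy : B * B) := (~` (xy.1 `&` xy.2))%O.
pose G n := iter n (fun S => S `|` nand @` (S `*` S)) (E `|` [set \top%O]).
have GS n : G n.+1 = G n `|` nand @` (G n `*` G n) by [].
have Gmono m n : (m <= n)%N -> G m `<=` G n.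
  elim: n => [|n IH]; first by rewrite leqn0 => /eqP->.
  rewrite leq_eqVlt => /orP[/eqP->//|]; rewrite ltnS => /IH mn.
  by rewrite GS => x /mn; left.
have GW n : G n #<= [set: W].
  elim: n => [|n IH].
    by apply: (card_le_setU ltwo) => //; apply: (countable_card_le W_uncountable).
  rewrite GS; apply: (card_le_setU ltwo) => //.
  apply: card_le_trans (card_image_le _ _) _.
  have [->|[g Gg]] := card_le_range IH; first by rewrite setX0 card_ge0.
  apply: card_le_trans (card_le_WW ltwo lt_countable W_uncountable).
  apply: card_le_trans (card_image_le (fun vw : W * W => (g vw.1, g vw.2)) setT).
  apply: subset_card_le => -[x y] [/=]; rewrite Gg => -[v _ <-] [w _ <-].
  by exists (v, w).
have nandG x y : (\bigcup_n G n) x -> (\bigcup_n G n) y ->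
    (\bigcup_n G n) (nand (x, y)).
  move=> [m _ mx] [n _ ny]; exists (maxn m n).+1 => //; rewrite GS; right.
  exists (x, y) => //; split=> /=.
    by apply: Gmono mx; apply: leq_maxl.
  by apply: Gmono ny; apply: leq_maxr.
have complG x : (\bigcup_n G n) x -> (\bigcup_n G n) (~` x)%O.
  by move=> Gx; have := nandG x x Gx Gx; rewrite /nand meetxx.
have topG : (\bigcup_n G n) \top%O by exists 0%N => //; right.
apply: card_le_trans (card_le_bigcup ltwo lt_countable W_uncountable
  (countable_card_le W_uncountable (countableP [set: nat])) (fun n _ => GW n)).
apply: subset_card_le; apply: sa_sub; last by move=> x Ex; exists 0%N => //; left.
split=> //.
- by rewrite -compl1; apply: complG.
- by move=> x y Gx Gy; rewrite -[(x `&` y)%O]complK; apply/complG/(nandG x y).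
- move=> x y Gx Gy; rewrite -[(x `|` y)%O]complK complU.
  by apply: (nandG (~` x)%O (~` y)%O); apply: complG.
Qed.

End Card.
End Generated.

(** * Subalgebras as boolean algebras in their own right *)

Section SubAlgebra.
Context {d : Order.disp_t} (B : ctbDistrLatticeType d) (S : set B).

(* The proof argument lets the instances below depend on closure of [S]. *)
Definition subalg of subalgebra S : Type := {x : B | x \in S}.

Variable SA : subalgebra S.

HB.instance Definition _ := SubChoice.on (subalg SA).

Let S0 : \bot%O \in S. Proof. by case: SA => *; rewrite inE. Qed.
Let S1 : \top%O \in S. Proof. by case: SA => *; rewrite inE. Qed.
Let SI : {in S &, forall u v, (u `&` v)%O \in S}.
Proof. by case: SA => _ _ _ SI _ x y; rewrite !inE; apply: SI. Qed.
Let SU : {in S &, forall u v, (u `|` v)%O \in S}.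
Proof. by case: SA => _ _ _ _ SU x y; rewrite !inE; apply: SU. Qed.
Let SC x : x \in S -> (~` x)%O \in S.
Proof. by case: SA => _ _ SC _ _; rewrite !inE; apply: SC. Qed.

HB.instance Definition _ :=
  Order.SubChoice_isTBSubLattice.Build d B (fun x => x \in S) d (subalg SA) SI SU S0 S1.

Lemma subalg_meetUl :
  left_distributive (@Order.meet d (subalg SA)) (@Order.join d (subalg SA)).
Proof. by move=> x y z; apply: val_inj; rewrite /= meetUl. Qed.

HB.instance Definition _ :=
  Order.Lattice_Meet_isDistrLattice.Build d (subalg SA) subalg_meetUl.

Definition subalg_compl (x : subalg SA) : subalg SA := Sub (~` val x)%O (SC (valP x)).

Lemma subalg_joinxC (x : subalg SA) : (x `|` subalg_compl x)%O = \top%O.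
Proof. by apply: val_inj; rewrite /= joinxC. Qed.

Lemma subalg_meetxC (x : subalg SA) : (x `&` subalg_compl x)%O = \bot%O.
Proof. by apply: val_inj; rewrite /= meetxC. Qed.

HB.instance Definition _ := Order.TBDistrLattice_hasComplement.Build d (subalg SA)
  subalg_joinxC subalg_meetxC.

Lemma subalg_val (x : B) : S x -> exists y : subalg SA, val y = x.
Proof. by move=> /mem_set Sx; exists (Sub x Sx); rewrite SubK. Qed.

(** Since [val] is an injective homomorphism, generation, and with it irredundance, can be computed
    in the ambient algebra. *)
Lemma sa_subalg (E : set (subalg SA)) (x : subalg SA) :
  sa E x <-> sa (val @` E) (val x).
Proof.
split.
  move: x; apply: sa_sub; last by move=> x Ex; apply: sub_sa; exists x.
  have [? ? C I U] := sa_subalgebra (val @` E).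
  by split=> //= [a|a b|a b]; [apply: C|apply: I|apply: U].
have [E0 E1 C I U] := sa_subalgebra E.
suff : sa (val @` E) `<=` val @` sa E by move=> /[apply] -[y Ey] /val_inj <-.
apply: sa_sub; last by move=> _ [y Ey <-]; exists y => //; apply: sub_sa.
split.
- by exists \bot%O.
- by exists \top%O.
- by move=> _ [a Ea <-]; exists (~` a)%O; [apply: C|].
- by move=> _ _ [a Ea <-] [b Eb <-]; exists (a `&` b)%O; [apply: I|].
- by move=> _ _ [a Ea <-] [b Eb <-]; exists (a `|` b)%O; [apply: U|].
Qed.

Lemma irredundant_subalg (E : set (subalg SA)) :
  irredundant E <-> irredundant (val @` E).
Proof.
have valD a : val @` (E `\ a) = (val @` E) `\ val a.
  apply/seteqP; split=> [_ [x [Ex xa] <-]|_ [[x Ex <-] xa]].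
    by split; [exists x|move=> /val_inj].
  by exists x => //; split=> // xa'; apply: xa; rewrite xa'.
split=> [Eirr _ [a Ea <-]|Eirr a Ea].
  by rewrite -valD -sa_subalg; apply: Eirr.
by rewrite sa_subalg valD; apply: Eirr; exists a.
Qed.

End SubAlgebra.

(** * Neighbours in algebras of sets *)

Lemma finite_set_ind T (P : set T -> Prop) :
    P set0 -> (forall x A, P A -> P (x |` A)) ->
  forall A, finite_set A -> P A.
Proof.
elim/Peq: T => T in P * => P0 PU A /finite_seqP[s ->].
elim: s => [|x s IH]; first by rewrite set_nil.
suff -> : [set` x :: s] = x |` [set` s] by apply: PU.
by apply/seteqP; split=> y /=; rewrite inE; [move=> /orP[/eqP|]; [left|right]|
   move=> [->|ys]; rewrite ?eqxx ?ys ?orbT].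
Qed.

(** [S x] is the least [R]-closed set containing [x]. It is contained in the union of countably many
    countable balls around [x]. *)
Lemma countable_components T (R : T -> T -> Prop) :
    (forall x y, R x y -> R y x) -> (forall x, countable [set y | R x y]) ->
  exists S : T -> set T,
    [/\ forall x, S x x, forall x y, S x y -> S y x,
        forall x y z, S x y -> R y z -> S x z & forall x, countable (S x)].
Proof.
move=> Rsym Rc.
exists (fun x y => forall Z : set T,
  (forall u v, Z u -> R u v -> Z v) -> Z x -> Z y).
split=> [x Z //|x y xy Z ZR Zy|x y z xy yz Z ZR Zx|x].
(* As [R] is symmetric, the complement of a closed set is closed. *)
- apply: contrapT => nZx; apply: (xy (~` Z)) Zy => // u v nZu uv Zv.
  by apply: nZu; apply: (ZR v) => //; apply: Rsym.
- exact: (ZR y z (xy Z ZR Zx) yz).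
pose ball n := iter n (fun Z => \bigcup_(u in Z) [set v | R u v]) [set x].
have ballc n : countable (ball n).
  by elim: n => [|n IH] /=; [exact: countable1|exact: bigcup_countable].
have Uc : countable (\bigcup_n ball n) by apply: bigcup_countable.
apply: sub_countable Uc; apply: subset_card_le => y; apply; last by exists 0%N.
by move=> u v [n _ nu] uv; exists n.+1 => //; exists u.
Qed.

Section SetAlgebra.
Context {W : Type}.
Implicit Types (E F : set (set W)) (a b c X Y : set W) (u v w : W).

Lemma sa_setI E X Y : sa E X -> sa E Y -> sa E (X `&` Y).
Proof. by have [_ _ _ I _] := sa_subalgebra E; exact: I. Qed.

Lemma sa_setU E X Y : sa E X -> sa E Y -> sa E (X `|` Y).
Proof. by have [_ _ _ _ U] := sa_subalgebra E; exact: U. Qed.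

Lemma sa_setC E X : sa E X -> sa E (~` X).
Proof. by have [_ _ C _ _] := sa_subalgebra E; exact: C. Qed.

Lemma sa_setD E X Y : sa E X -> sa E Y -> sa E (X `\` Y).
Proof. by move=> EX EY; rewrite setDE; apply: sa_setI => //; apply: sa_setC. Qed.

Lemma sa_setT E : sa E setT.
Proof. by have [] := sa_subalgebra E. Qed.

Lemma sa_set0 E : sa E set0.
Proof. by have [] := sa_subalgebra E. Qed.

Lemma subalgebra_set (S : set (set W)) :
  S setT -> (forall X, S X -> S (~` X)) ->
  (forall X Y, S X -> S Y -> S (X `&` Y)) -> subalgebra S.
Proof.
move=> S1 SC SI; split=> //; first by rewrite botEset -setCT; apply: SC.
by move=> X Y SX SY; rewrite joinEset -[X `|` Y]setCK setCU; apply/SC/SI; apply: SC.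
Qed.

(** Normal form for one new generator: sets that follow one element of [sa E] on [b] and another off
    [b] already form a subalgebra. *)
Lemma sa_setU1 E b X : sa (b |` E) X ->
  exists c d, [/\ sa E c, sa E d & X = (c `&` b) `|` (d `\` b)].
Proof.
move: X; apply: sa_sub; first apply: subalgebra_set.
- exists setT, setT; split; [exact: sa_setT|exact: sa_setT|].
  by rewrite setTI setTD setUv.
- move=> X [c [d [Ec Ed ->]]]; exists (~` c), (~` d).
  split; [exact: sa_setC|exact: sa_setC|].
  by apply/seteqP; split=> x /=; have [] := pselect (b x); tauto.
- move=> X Y [c [d [Ec Ed ->]]] [c' [d' [Ec' Ed' ->]]].
  exists (c `&` c'), (d `&` d'); split; [exact: sa_setI|exact: sa_setI|].
  by apply/seteqP; split=> x /=; tauto.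
- move=> X [->|EX]; [exists setT, set0|exists X, X].
    split; [exact: sa_setT|exact: sa_set0|].
    by rewrite setTI set0D setU0.
  split; [exact: sub_sa|exact: sub_sa|].
  by apply/seteqP; split=> x /=; have [] := pselect (b x); tauto.
Qed.

Lemma irredundantU1 E b :
    irredundant E -> ~ sa E b ->
    (forall a c d, E a -> sa (E `\ a) c -> sa (E `\ a) d ->
       a <> (c `&` b) `|` (d `\` b)) ->
  irredundant (b |` E).
Proof.
move=> Eirr nEb H x [->|Ex] sax.
  by apply: nEb; apply: sa_mono sax => y [[->|//] []].
have xb : x <> b by move=> xb; apply: nEb; rewrite -xb; apply: sub_sa.
have [|c [d [Ec Ed]]] := @sa_setU1 (E `\ x) b x; last exact: H.
by apply: sa_mono sax => y [[->|Ey] yx]; [left|right].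
Qed.

(** If [[set w]] made [a] redundant, then [a] would differ from some [d] in [sa (E \ a)] at most at
    [w]. The symmetric difference is in [sa E], so it is not [[set w]]; hence [a = d], contrary to
    irredundance. *)
Lemma irredundantU_singleton E w :
  irredundant E -> ~ sa E [set w] -> irredundant ([set w] |` E).
Proof.
move=> Eirr nEw; apply: irredundantU1 => // a c d Ea Ec Ed aE.
have sad : sa E d by apply: sa_mono Ed => ? [].
have saa : sa E a by apply: sub_sa.
have ad v : v <> w -> a v <-> d v.
  by move=> vw; rewrite aE; split=> [[[]|[]]//|dv]; right.
apply: nEw; suff -> : [set w] = (a `\` d) `|` (d `\` a).
  by apply: sa_setU; apply: sa_setD.
apply/seteqP; split=> v; last first.
  by have [-> //|/ad] := pselect (v = w); rewrite /=; tauto.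
move=> ->; apply: contrapT => /not_orP[/not_andP nad /not_andP nda].
apply: (Eirr a Ea); suff ad' : a = d by rewrite {2}ad'.
apply/seteqP; split=> u; have [->|/ad] := pselect (u = w); try tauto.
- by case: nad => // /contrapT.
- by case: nda => // /contrapT.
Qed.

(** Finite intersections over [Y] and then finite unions over [X] of separating sets yield an [f]
    that contains [X] and misses [Y]; it cuts [X] out of the union. *)
Lemma sa_of_separated E X Y :
    finite_set X -> finite_set Y -> X `&` Y = set0 -> sa E (X `|` Y) ->
    (forall u v, X u -> Y v -> exists f, [/\ sa E f, f u & ~ f v]) ->
  sa E X.
Proof.
move=> Xfin Yfin XY0 EXY sep.
suff [f [Ef Xf fY]] : exists f, [/\ sa E f, X `<=` f & f `&` Y = set0].
  suff -> : X = f `&` (X `|` Y) by apply: sa_setI.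
  by rewrite setIUr fY setU0; apply/esym/setIidr.
suff sepY u : X u -> exists f, [/\ sa E f, f u & f `&` Y = set0].
  move: Xfin sepY {XY0 EXY sep}; elim/finite_set_ind: X / => [_|u X IH sepY].
    by exists set0; split; [exact: sa_set0| |rewrite set0I].
  have [v Xv|f [Ef Xf fY]] := IH; first by apply: sepY; right.
  have [|g [Eg gu gY]] := sepY u; first by left.
  exists (g `|` f); split; first exact: sa_setU.
    by move=> v [->|/Xf]; [left|right].
  by rewrite setIUl gY fY setU0.
move=> Xu; have {sep} := fun v => sep u v Xu.
move: Yfin {XY0 EXY}; elim/finite_set_ind: Y / => [_|v Y IH sep].
  by exists setT; split; [exact: sa_setT| |rewrite setI0].
have [v' Yv'|f [Ef fu fY]] := IH; first by apply: sep; right.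
have [|g [Eg gu gv]] := sep v; first by left.
exists (g `&` f); split; [exact: sa_setI|by []|].
rewrite -subset0 => w [[gw fw] [wv|Yw]]; first by apply: gv; rewrite -wv.
by rewrite -fY.
Qed.

Definition agree E u v : Prop := forall e, E e -> e u <-> e v.

Lemma agree_sym E u v : agree E u v -> agree E v u.
Proof. by move=> uv e Ee; have [? ?] := uv e Ee. Qed.

Lemma sa_agree E u v : agree E u v -> agree (sa E) u v.
Proof.
move=> Euv; apply: sa_sub => //; apply: subalgebra_set => //.
- by move=> X /= ->.
- by move=> X Y /= -> ->.
Qed.

Definition neighbours E u v : Prop := exists2 a, E a & agree (E `\ a) u v.

Lemma neighbours_sym E u v : neighbours E u v -> neighbours E v u.
Proof. by move=> [a Ea uv]; exists a => //; apply: agree_sym. Qed.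

(* The set of the [a] in [E] on which [X] depends. *)
Lemma countable_dependence E X : sa E X ->
  countable [set a | exists u v, [/\ agree (E `\ a) u v, X u & ~ X v]].
Proof.
move: X; apply: sa_sub; first apply: subalgebra_set.
- apply: sub_countable (countable0 (set W)); apply: subset_card_le.
  by move=> a [u [v []]].
- move=> X; apply: sub_countable; apply: subset_card_le => a [u [v [uv nXu nXv]]].
  by exists v, u; split=> //; [exact: agree_sym|exact: contrapT].
- move=> X Y Xc Yc; apply: sub_countable (countableU Xc Yc).
  apply: subset_card_le => a [u [v [uv [Xu Yu] nXYv]]].
  have [Xv|nXv] := pselect (X v); last by left; exists u, v.
  by right; exists u, v; split=> // Yv; apply: nXYv.
(* A generator [e] depends at most on itself: for [a] other than [e], points that agree on [E]
   without [a] agree on [e]. *)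
- move=> e Ee; apply: sub_countable (countable1 e).
  apply: subset_card_le => a [u [v [uv eu nev]]] /=.
  by apply: contrapT => ae; apply/nev/(uv e) => //; split=> // ea; apply: ae.
Qed.

Lemma neighbours_countable E u :
  (forall w, sa E [set w]) -> countable [set v | neighbours E u v].
Proof.
move=> Esing; have Ac := countable_dependence (Esing u).
set A := (X in countable X) in Ac.
have agree_eq v w : agree E v w -> v = w.
  by move=> vw; have [/(_ erefl)] := sa_agree vw (Esing v).
pose N a := [set v | [/\ E a, v <> u & agree (E `\ a) u v]].
have Nc a : countable (N a).
  have [->|/set0P[v [Ea vu uv]]] := eqVneq (N a) set0; first exact: countable0.
  (* A point of [N a] on the same side of [a] as [u] would agree with [u] on all of [E]. So any two
     points of [N a] are on the other side, agree on [E], and coincide. *)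
  have auv w : N a w -> a u <-> ~ a w.
    move=> [_ wu uw]; split=> [au aw|naw]; last apply: contrapT => nau.
      apply/wu/esym/agree_eq => e Ee; have [->|ea] := pselect (e = a); first by [].
      exact: uw.
    apply/wu/esym/agree_eq => e Ee; have [->|ea] := pselect (e = a); first by [].
    exact: uw.
  apply: sub_countable (countable1 v); apply: subset_card_le => w Nw /=.
  apply: agree_eq => e Ee; have [->|ea] := pselect (e = a).
    have := auv v (And3 Ea vu uv); have := auv w Nw.
    by have [] := pselect (a v); have [] := pselect (a w); tauto.
  have [_ _ uw] := Nw; have ? : (E `\ a) e by [].
  by rewrite -(uv e)// -(uw e).
apply: (@sub_countable _ _ _ ([set u] `|` \bigcup_(a in A) N a)); last first.
  by apply: countableU; [exact: countable1|exact: bigcup_countable].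
apply: subset_card_le => v [a Ea uv].
have [->|vu] := pselect (v = u); first by left.
(* The pair [u], [v] itself shows that [[set u]] depends on [a]. *)
by right; exists a => //; exists u, v; split=> // /vu.
Qed.

End SetAlgebra.

(** * Construction of the algebra *)

Definition finite_or_uncountable T (X : set T) : Prop :=
  finite_set X \/ ~ countable X.

Definition splits T (b X : set T) : Prop :=
  ~ countable (X `&` b) /\ ~ countable (X `\` b).

Lemma uncountable_sub T (X Y : set T) :
  X `<=` Y -> ~ countable X -> ~ countable Y.
Proof. by move=> XY Xnc /(sub_countable (subset_card_le XY)). Qed.

Lemma finite_or_uncountable_splits T (b c d : set T) :
    finite_or_uncountable c -> finite_or_uncountable d ->
    (~ countable c -> splits b c) -> (~ countable d -> splits b d) ->
  finite_or_uncountable ((c `&` b) `|` (d `\` b)).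
Proof.
move=> [cfin|cnc] cd bc bd; last first.
  by right; apply: uncountable_sub (bc cnc).1; apply: subsetUl.
case: cd => [dfin|dnc]; last first.
  by right; apply: uncountable_sub (bd dnc).2; apply: subsetUr.
by left; rewrite finite_setU; split; [apply: finite_setIl|apply: finite_setD].
Qed.

Definition singletons T : set (set T) := range set1.
Arguments singletons : clear implicits.

(** Singletons generate only finite and cofinite sets. This is the base of the construction. *)
Lemma sa_singletons T (X : set T) :
  ~ countable [set: T] -> sa (singletons T) X -> finite_or_uncountable X.
Proof.
move=> Tnc; suff : sa (singletons T) `<=` [set X | finite_set X \/ cofinite_set X].
  move=> /[apply] -[|Xc]; [by left|right].
  by rewrite -[X]setCK -setTD; apply/uncountable_setD/finite_set_countable.
apply: sa_sub => [|_ [w _ <-]]; last by left.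
apply: subalgebra_set.
- by right; rewrite setCT.
- by move=> Y [|] Yf; [right; rewrite setCK|left].
- move=> Y Z [Yf|Yc]; first by left; apply: finite_setIl.
  move=> [Zf|Zc]; first by left; apply: finite_setIr.
  by right; rewrite cofinite_setI.
Qed.

(** Every maximal irredundant set of the final algebra has these properties, so only such families
    have to be defeated by a splitting set. *)
Definition extendable T (E : set (set T)) : Prop :=
  [/\ irredundant E, forall w, sa E [set w] &
      forall X, sa E X -> finite_or_uncountable X].

Lemma splitting_irredundant T (E : set (set T)) (b : set T) :
    ~ countable [set: T] -> extendable E ->
    (forall X, sa E X -> ~ countable X -> splits b X) ->
    (forall u v, b u -> neighbours E u v -> b v) ->
  irredundant (b |` E) /\ ~ E b.
Proof.
move=> Tnc [Eirr Esing Efou] Esplit bE.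
(* Otherwise [b] or its complement would be an uncountable element of [sa E], and [b] splits
   neither. *)
have Eb : ~ sa E b.
  move=> Eb; have Ecb := sa_setC Eb.
  have [bfin|bnc] := Efou _ Eb; last first.
    by have [_] := Esplit _ Eb bnc; rewrite setDv.
  have cbnc : ~ countable (~` b).
    by rewrite -setTD; apply/uncountable_setD/finite_set_countable.
  by have [] := Esplit _ Ecb cbnc; rewrite setICl.
split; last by move=> /sub_sa.
apply: irredundantU1 => // a c d Ea Fc Fd aE.
have sub_F : sa (E `\ a) `<=` sa E by apply: sa_mono => ? [].
have saa : sa E a by apply: sub_sa.
have abc w : b w -> a w <-> c w by move=> bw; rewrite aE; split=> [[[]|[]]//|]; left.
have abd w : ~ b w -> a w <-> d w by move=> bw; rewrite aE; split=> [[[]|[]]//|]; right.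
pose x := (a `\` d) `|` (d `\` a).
pose y := (a `\` c) `|` (c `\` a).
have xb w : x w -> b w by move=> xw; apply: contrapT => /abd; case: xw => -[]; tauto.
have yb w : y w -> ~ b w by move=> yw /abc; case: yw => -[]; tauto.
have Ex : sa E x by apply: sa_setU; apply: sa_setD => //; apply: sub_F.
have Ey : sa E y by apply: sa_setU; apply: sa_setD => //; apply: sub_F.
(* An uncountable element of [sa E] has points on both sides of [b], whereas [x] lies inside [b] and
   [y] outside. *)
have xfin : finite_set x.
  have [//|xnc] := Efou _ Ex; have [_] := Esplit _ Ex xnc.
  by rewrite (_ : x `\` b = set0)// -subset0 => w [/xb].
have yfin : finite_set y.
  have [//|ync] := Efou _ Ey; have [+ _] := Esplit _ Ey ync.
  by rewrite (_ : y `&` b = set0)// -subset0 => w [/yb].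
have xy0 : x `&` y = set0 by rewrite -subset0 => w [/xb bw /yb].
(* The union is the symmetric difference of [c] and [d], from which [a] has disappeared. *)
have Fxy : sa (E `\ a) (x `|` y).
  suff -> : x `|` y = (c `\` d) `|` (d `\` c) by apply: sa_setU; apply: sa_setD.
  apply/seteqP; split=> w; rewrite /x /y /=; have [/abc|/abd] := pselect (b w);
  by have [] := pselect (a w); tauto.
have Fx : ~ sa (E `\ a) x.
  move=> Fx; apply: (Eirr a Ea).
  suff {2}-> : a = (x `\` d) `|` (d `\` x) by apply: sa_setU; apply: sa_setD.
  apply/seteqP; split=> w; rewrite /x /=;
  by have [] := pselect (a w); have [] := pselect (d w); tauto.
apply: Fx; apply: (sa_of_separated xfin yfin xy0 Fxy) => u v xu yv.
apply: contrapT => nsep; apply: (yb v yv); apply: (bE u); first exact: xb.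
exists a => // e Ee; have Fe : sa (E `\ a) e by apply: sub_sa.
split=> [eu|ev]; apply: contrapT => ne; apply: nsep; first by exists e.
by exists (~` e); split=> //; apply: sa_setC.
Qed.

Section Construction.
Variables (W : Type) (lt : W -> W -> Prop).
Hypotheses (ltwo : is_wo lt) (lt_countable : forall w, countable [set v | lt v w]).
Hypothesis W_uncountable : ~ countable [set: W].

(** At each [w] two points of a listed set are chosen, in classes [S] different from each other and
    from those of all earlier points. The classes of the first points make up [b]; the second points
    stay outside. *)
Lemma saturated_bernstein (R : W -> W -> Prop) (S : W -> set W) (G : set (set W)) :
    (forall u, S u u) -> (forall u v, S u v -> S v u) ->
    (forall u v w, S u v -> R v w -> S u w) -> (forall u, countable (S u)) ->
    G #<= [set: W] -> (forall X, G X -> ~ countable X) ->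
  exists b : set W, (forall u v, b u -> R u v -> b v) /\ forall X, G X -> splits b X.
Proof.
move=> Srefl Ssym SR Sc GW Gnc.
have [G0|[g Gg]] := card_le_range GW; first by exists set0; split=> // X; rewrite G0.
have [p pinj] := inj_WW ltwo lt_countable W_uncountable.
(* [X] lists the members of [G], each of them uncountably often. *)
have /choice[X XP] : forall w, exists X : set W,
    ~ countable X /\ forall uv, p uv = w -> X = g uv.1.
  move=> w; have [[uv uvw]|nuv] := pselect (exists uv, p uv = w).
    exists (g uv.1); split; first by apply: Gnc; rewrite Gg; exists uv.1.
    by move=> uv' uv'w; rewrite (pinj uv uv')// uvw.
  by exists setT; split=> // uv uvw; case: nuv; exists uv.
have [w D Dc|c [cP crel]] := wo_greedy_choice ltwo lt_countable
    (P := fun w => [set t : W * W | [/\ X w t.1, X w t.2 & ~ S t.1 t.2]])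
    (rel := fun s t => [/\ ~ S s.1 t.1, ~ S s.2 t.1, ~ S s.1 t.2 & ~ S s.2 t.2]).
  pose Z := \bigcup_(s in D) (S s.1 `|` S s.2).
  have Zc : countable Z by apply: bigcup_countable => // s _; apply: countableU.
  have [x [Xx Zx]] := uncountable_nonempty (uncountable_setD (XP w).1 Zc).
  have [|y [Xy /not_orP[Zy Sxy]]] := @uncountable_nonempty _ (X w `\` (Z `|` S x)).
    by apply: uncountable_setD; [exact: (XP w).1|exact: countableU].
  exists (x, y) => // s Ds; split=> /= ?; try (by apply: Zx; exists s; [|left]);
    try (by apply: Zx; exists s; [|right]); try (by apply: Zy; exists s; [|left]);
    by apply: Zy; exists s; [|right].
have [_ _ tot] := ltwo.
have c12 v w : ~ S (c v).1 (c w).2.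
  have [/crel[]//|->|/crel[_ + _ _]] := tot v w; first by have [] := cP w.
  by move=> + /Ssym.
have c1inj v w : (c v).1 = (c w).1 -> v = w.
  move=> vw; have [/crel[]|//|/crel[]] := tot v w; by rewrite vw.
have c2inj v w : (c v).2 = (c w).2 -> v = w.
  move=> vw; have [/crel[]|//|/crel[]] := tot v w; by rewrite vw.
exists (\bigcup_w S (c w).1); split=> [u v [w _ wu] uv|Y].
  by exists w => //; apply: SR uv.
rewrite Gg => -[u _ <-].
have Xp v : X (p (u, v)) = g u by have [_ /(_ (u, v) erefl)] := XP (p (u, v)).
split=> nc; apply: W_uncountable; apply: sub_countable nc.
(* The set [g u] is listed at [p (u, v)] for every [v], and distinct [v] give distinct chosen
   points. *)
- apply: (@card_le_injfun _ _ _ _ (fun v => (c (p (u, v))).1))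
    => [v _|v v' _ _ /c1inj/pinj[]//].
  by split; [rewrite -(Xp v); have [] := cP (p (u, v))|exists (p (u, v))].
- apply: (@card_le_injfun _ _ _ _ (fun v => (c (p (u, v))).2))
    => [v _|v v' _ _ /c2inj/pinj[]//].
  by split; [rewrite -(Xp v); have [] := cP (p (u, v))|move=> [w _] /c12].
Qed.

(** One stage of the recursion: [C] is the algebra built so far and [E] the family to be treated. *)
Lemma splitting_extension (C E : set (set W)) :
    C #<= [set: W] -> E #<= [set: W] ->
  exists b, (forall X, C X -> ~ countable X -> splits b X) /\
    (extendable E -> irredundant (b |` E) /\ ~ E b).
Proof.
move=> CW EW; have [Eext|nE] := pselect (extendable E); last first.
  (* No saturation is required here, so the empty relation with one-point classes is used. *)
  have [//|//|//|u|||b [_ bC]] := @saturated_bernstein (fun _ _ => False) set1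
    (C `&` [set X | ~ countable X]).
  - exact: countable1.
  - exact: card_le_trans (subset_card_le (@subIsetl _ _ _)) CW.
  - by move=> X [].
  - by exists b; split=> // X CX Xnc; apply: bC.
have [Eirr Esing Efou] := Eext.
have [S [Srefl Ssym SN Sc]] := countable_components (@neighbours_sym _ E)
  (fun u => neighbours_countable u Esing).
(* The elements of [sa E] are split as well, since [E] is arbitrary and may reach outside [C]. *)
have [||b [bN bC]] := saturated_bernstein
  (G := (C `|` sa E) `&` [set X | ~ countable X]) Srefl Ssym SN Sc.
- apply: card_le_trans (subset_card_le (@subIsetl _ _ _)) _.
  by apply: (card_le_setU ltwo) => //; apply: (card_le_sa ltwo).
- by move=> X [].
exists b; split=> [X CX Xnc|_]; first by apply: bC; split=> //; left.
by apply: splitting_irredundant => // X EX Xnc; apply: bC; split=> //; right.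
Qed.

Lemma extending_subalgebra I (ltI : I -> I -> Prop) (e : I -> set (set W)) :
    is_wo ltI -> (forall i, [set j | ltI j i] #<= [set: W]) ->
    (forall i, e i #<= [set: W]) ->
  exists A : set (set W),
    [/\ subalgebra A, forall w, A [set w], forall X, A X -> finite_or_uncountable X &
        forall i, extendable (e i) ->
          exists b, [/\ A b, irredundant (b |` e i) & ~ e i b]].
Proof.
move=> ltIwo ltIW eW; have [ltIwf ltItr ltItot] := ltIwo.
have singW : singletons W #<= [set: W] by apply: card_image_le.
have [i D Di|c cP] := @wf_choice _ _ ltI (fun i D b =>
    (forall X, sa (singletons W `|` D) X -> ~ countable X -> splits b X) /\
    (extendable (e i) -> irredundant (b |` e i) /\ ~ e i b)) ltIwf.
  apply: splitting_extension => //; apply: (card_le_sa ltwo) => //.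
  by apply: (card_le_setU ltwo) => //; apply: card_le_trans (ltIW i).
pose G J := singletons W `|` c @` J; pose below i := [set j | ltI j i].
(* Used for initial segments and for all of [I]. An element of [sa (G J)] lies, for some [j] in [J],
   in the algebra generated by [c j] and [G (below j)]; its normal form and the splitting property
   of [c j] do the rest. *)
have step (J : set I) :
    (forall j X, J j -> sa (G (below j)) X -> finite_or_uncountable X) ->
  forall X, sa (G J) X -> finite_or_uncountable X.
  move=> IH X; have [->|/set0P J0] := eqVneq J set0.
    by rewrite /G image_set0 setU0; apply: sa_singletons.
  have GJ : G J `<=` \bigcup_(j in J) (c j |` G (below j)).
    move=> Y [Ys|[j Jj <-]]; last by exists j => //; left.
    by have [j Jj] := J0; exists j => //; right; left.
  have chain j k : ltI j k -> (c j |` G (below j)) `<=` (c k |` G (below k)).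
    move=> jk Y [->|[Ys|[l lj <-]]]; right; [right; exists j => //|by left|right].
    by exists l => //; apply: ltItr jk.
  move=> /(sa_mono GJ) /sa_bigcup_chain[//|j k _ _|j Jj /sa_setU1[p [q [jp jq ->]]]].
    by have [/chain|->|/chain] := ltItot j k; [left|left|right].
  have [cj _] := cP j.
  by apply: finite_or_uncountable_splits; [exact: IH jp|exact: IH jq|exact: cj|exact: cj].
have below_finite_or_uncountable j X : sa (G (below j)) X -> finite_or_uncountable X.
  by elim: (ltIwf j) X => {}j _ IH; apply: step => k X /IH; apply.
exists (sa (G setT)); split.
- exact: sa_subalgebra.
- by move=> w; apply: sub_sa; left; exists w.
- by apply: step => j X _; apply: below_finite_or_uncountable.
- move=> i /(cP i).2[irr neb]; exists (c i); split=> //.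
  by apply: sub_sa; right; exists i.
Qed.

End Construction.

(** * The algebra as a boolean algebra *)

Lemma aleph1_least_uncountable T (A : set T) : is_aleph 1 A ->
  ~ countable A /\ forall V (C : set V), ~ countable C -> A #<= C.
Proof.
move=> [U [N [Nnat [[NA AN] Amin]]]]; have /card_eqPle[Nle natN] := Nnat.
split=> [Ac|V C Cnc]; first exact/AN/card_le_trans/natN.
apply: Amin; split; last by move=> /card_le_trans/(_ Nle).
apply: card_le_trans Nle _; apply/infiniteP.
by move=> /finite_set_countable.
Qed.

(** Serves to exclude an empty maximal irredundant set: the empty set generates only [set0] and
    [setT]. *)
Lemma sa_set0_singleton T (w : T) :
  sa (@set0 (set T)) [set w] -> countable [set: T].
Proof.
move=> saw; suff : sa (@set0 (set T)) `<=` [set X | X = set0 \/ X = setT].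
  move=> /(_ _ saw)[w0|<-]; last exact: countable1.
  by have : (set0 : set T) w by rewrite -w0.
apply: sa_sub => //; apply: subalgebra_set.
- by right.
- by move=> X [->|->]; [right; rewrite setC0|left; rewrite setCT].
- by move=> X Y [->|->]; [left; rewrite set0I|rewrite setTI].
Qed.

Section SubalgebraOfSets.
Variables (T : Type) (A : set (set T)) (Asub : subalgebra A).
Hypothesis Asing : forall w, A [set w].
Local Notation B := (subalg Asub).

Lemma subalg_le (x y : B) : (x <= y)%O -> val x `<=` val y.
Proof. by rewrite -Order.le_val => /subsetPset. Qed.

Lemma subalg_singletons :
  exists s : T -> B, forall w, val (s w) = [set w].
Proof. by have /choice[s sE] := fun w => subalg_val Asub (Asing w); exists s. Qed.

Lemma singleton_le (s : T -> B) (x : B) w : (forall w, val (s w) = [set w]) ->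
  val x w -> (s w <= x)%O.
Proof. by move=> sE xw; rewrite -Order.le_val; apply/subsetPset; rewrite sE => v ->. Qed.

Lemma subalg_nonempty (x : B) : x <> \bot%O -> val x !=set0.
Proof.
by move=> x0; apply/set0P/eqP => vx0; apply: x0; apply: val_inj.
Qed.

Lemma singleton_atom (s : T -> B) w : (forall w, val (s w) = [set w]) -> atom (s w).
Proof.
move=> sE; split=> [/(congr1 val)|x /subalg_le].
  by rewrite sE => /seteqP[/(_ w erefl)].
have [->|x0] := pselect (x = \bot%O); [by left|move=> xw; right; apply: val_inj].
have [v xv] := subalg_nonempty x0.
move: xw; rewrite sE => xw; apply/seteqP; split=> // u ->.
by rewrite -(xw v xv).
Qed.

Lemma subalg_atomic : atomic B.
Proof.
move=> x /subalg_nonempty[w xw]; have [s sE] := subalg_singletons.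
by exists (s w); [apply: singleton_atom|apply: singleton_le].
Qed.

(** The singletons are dense, and being atoms they belong to every dense set. *)
Lemma subalg_pi_weight : is_pi_weight B [set: T].
Proof.
have [s sE] := subalg_singletons.
have sinj : injective s.
  by move=> u v /(congr1 val); rewrite !sE => /seteqP[/(_ u erefl)].
split.
  exists (range s); last by apply: inj_card_eq => u v _ _; apply: sinj.
  move=> x /subalg_nonempty[w xw]; exists (s w); split; first by exists w.
    by have [] := singleton_atom w sE.
  exact: singleton_le.
move=> S Sdense; apply: (@card_le_injfun _ _ _ _ s) => [w _|u v _ _]; last exact: sinj.
have [sw0 satom] := singleton_atom w sE.
by have [x [Sx x0 xw]] := Sdense _ sw0; have [//|<-] := satom x xw.
Qed.

Lemma subalg_maximal_irredundant (S : set B) :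
  maximal_irredundant S -> forall w, sa (val @` S) [set w].
Proof.
move=> [Sirr Smax] w; apply: contrapT => nw.
have [s sE] := subalg_singletons.
have : irredundant (s w |` S).
  rewrite irredundant_subalg image_setU image_set1 sE.
  by apply: irredundantU_singleton => //; rewrite -irredundant_subalg.
move=> /Smax SsS; apply: nw; apply: sub_sa; exists (s w) => //.
by rewrite -SsS; [left|apply: subsetUr].
Qed.

End SubalgebraOfSets.

(* W is any type of cardinality aleph_1, so [W -> bool] has cardinality
   2 ^ aleph_1. *)
Theorem theorem1p14 (W : Type) (W_aleph1 : is_aleph 1 [set: W])
    (pow_aleph1 : is_aleph 2 [set: W -> bool]) :
  exists (d : Order.disp_t) (B : ctbDistrLatticeType d),
    [/\ atomic B,
        is_pi_weight B [set: W] &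
        exists2 I : set B, is_Irr_mm B I & card_lt [set: W] I].
Proof.
have [Wnc Wmin] := aleph1_least_uncountable W_aleph1.
have [U [K [/aleph1_least_uncountable[_ Kmin] [_ Pmin]]]] := pow_aleph1.
have KW : K #<= [set: W] by apply: Kmin.
(* This is where the cardinal hypothesis enters: what exceeds [W] is at least as large as
   [W -> bool]. *)
have not_le_W V (C : set V) : ~ (C #<= [set: W]) ->
    [set: W] #<= C /\ [set: W -> bool] #<= C.
  move=> CW; have WC : [set: W] #<= C.
    by apply: Wmin => /(countable_card_le Wnc).
  split=> //; apply: Pmin; split; first exact: card_le_trans WC.
  by move=> /card_le_trans/(_ KW).
have [lt ltwo ltc] := wo_short_exists (Wmin W).
have [ltP ltPwo ltPW] := wo_short_exists (fun C CW => (not_le_W _ C CW).2).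
have [p pinj] := inj_WW ltwo ltc Wnc.
(* Through the pairing [p], [f] codes a [W]-indexed family of subsets of [W]; every nonempty family
   of size at most that of [W] has a code. *)
pose e (f : W -> bool) := range (fun w => [set v | f (p (w, v))]).
have eW f : e f #<= [set: W] by apply: card_image_le.
have e_surj (g : W -> set W) : exists f, e f = range g.
  exists (fun u => `[< exists w v, u = p (w, v) /\ g w v >]).
  rewrite /e; congr (_ @` _); apply/funext => w; apply/seteqP; split=> v /=.
    by move=> /asboolP[w' [v' [/pinj[-> ->]]]].
  by move=> gwv; apply/asboolP; exists w, v.
have [A [Asub Asing Afou Aext]] := extending_subalgebra ltwo ltc Wnc ltPwo ltPW eW.
exists set_display, (subalg Asub); split.
- exact: subalg_atomic.
- exact: subalg_pi_weight.
have max_not_le (S : set (subalg Asub)) :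
    maximal_irredundant S -> ~ (S #<= [set: W]).
  move=> Smax SW; have Ssing := subalg_maximal_irredundant Asing Smax.
  have [Sirr Seq] := Smax.
  have SA : sa (val @` S) `<=` A.
    by apply: sa_sub => // _ [x _ <-]; have := valP x; rewrite inE.
  have Sext : extendable (val @` S).
    by split=> // [|X /SA /Afou //]; rewrite -irredundant_subalg.
  have [S0|[g Sg]] := card_le_range (card_le_trans (card_image_le val S) SW).
    have [w _] := uncountable_nonempty Wnc.
    by apply: Wnc; apply: (@sa_set0_singleton _ w); rewrite -S0.
  have [f ef] := e_surj g; rewrite -ef in Sg.
  have [|b [Ab irrb nb]] := Aext f; first by rewrite -Sg.
  have [y yb] := subalg_val Asub Ab; rewrite -Sg -yb in irrb nb.
  apply: nb; exists y => //; rewrite -(Seq (y |` S)); [by left| |exact: subsetUr].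
  by rewrite irredundant_subalg image_setU image_set1.
(* Any maximal irredundant [I] attains the minimum: each one is at least as large as [W -> bool],
   into which the whole algebra embeds. *)
have [I Imax] := maximal_irredundant_exists (subalg Asub).
have [WI _] := not_le_W _ _ (max_not_le _ Imax).
exists I; last by split=> //; apply: max_not_le.
split=> [|S Smax]; first by exists I.
apply: card_le_trans (card_leT I) _.
apply: card_le_trans (not_le_W _ _ (max_not_le _ Smax)).2.
apply: (@card_le_injfun _ _ _ _ (fun x w => `[< val x w >])) => // x y _ _ /funeqP xy.
apply: val_inj; apply/seteqP; split=> w;
by have [? ?] := asbool_eq_equiv (xy w).
Qed.
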